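(* Let $G\le\mathrm{Aut}(T)$ be a weakly branch group and $\mathcal{H}$ a uniformly recurrent subgroup of $G$. Then: (i) the map $\mathcal{H}\to\mathcal{F}(\partial T)$, $H\mapsto\mathrm{Fix}(H)$, is continuous; (ii) there exists a continuous $G$-equivariant map $\sigma:F_{\mathcal{H}}\to\Pi(T)$ such that (a) $\pi_\perp\circ\sigma=\mathrm{id}$, and (b) for every $H\in\mathcal{H}$ and every $v\in\sigma(\mathrm{Fix}(H))$ one has $\mathrm{Rist}_G(v)'\le H$.
   Context: $T$ is a locally finite rooted tree, $\mathrm{Aut}(T)$ the root-fixing automorphisms, $\partial T$ the boundary; for a vertex $v$, $T_v$ is the subtree below $v$, $\partial T_v$ the corresponding clopen subset of $\partial T$, and $\mathrm{Rist}_G(v)$ the set of elements of $G$ acting trivially outside $T_v$; $K'$ is the derived subgroup. $G$ is weakly branch if $T$ is infinite and spherically homogeneous, $G$ acts transitively on each level, and $\mathrm{Rist}_G(v)\ne\{1\}$ for all $v$. $\mathrm{Sub}(G)$ is the space of subgroups with the Chabauty topology (product topology on $\{0,1\}^G$) and conjugation action; a uniformly recurrent subgroup is a closed minimal $G$-invariant subset of $\mathrm{Sub}(G)$. $\mathcal{F}(\partial T)$ is the space of closed subsets of $\partial T$ with the Hausdorff topology. For $H\le\mathrm{Aut}(T)$, $\mathrm{Fix}(H)\subset\partial T$ is its set of fixed points, and $F_{\mathcal{H}}=\{\mathrm{Fix}(H):H\in\mathcal{H}\}$. Two vertices $v,w$ are independent if $T_v\cap T_w=\varnothing$; $\Pi(T)$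 is the set of sets of pairwise independent vertices of $T$, with the topology induced from the product topology on the power set $\{0,1\}^{V(T)}$ of the vertex set. The map $\pi_\perp:\Pi(T)\to\mathcal{F}(\partial T)$ is $\pi_\perp(\mathcal{V})=\partial T\setminus\bigsqcup_{v\in\mathcal{V}}\partial T_v$. *)

(* Defs.v *)
(* Concrete model of a spherically homogeneous
   rooted tree with branching sequence m : vertices of level n are words
   [x_0; ...; x_(n-1)] with x_i < m i; boundary points are x : nat -> nat
   with x i < m i for all i. *)
From Stdlib Require List.
From mathcomp Require Import all_boot.
Set Implicit Arguments. Unset Strict Implicit. Unset Printing Implicit Defensive.

Definition vert := seq nat.
Definition bpoint := nat -> nat.
Definition tfun := vert -> vert.

Definition isvert (m : nat -> nat) (v : vert) : Prop :=
  forall i, i < size v -> nth 0 v i < m i.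
Definition isbd (m : nat -> nat) (x : bpoint) : Prop := forall i, x i < m i.
Definition trunc (x : bpoint) (n : nat) : vert := mkseq x n.
Definition in_bd_subtree (v : vert) (x : bpoint) : Prop := trunc x (size v) = v.

(* root-fixing tree automorphisms: level- and ancestor-preserving bijections
   of the vertex set (normalized to be the identity on non-vertices) *)
Definition is_aut (m : nat -> nat) (g : tfun) : Prop :=
  (forall v, ~ isvert m v -> g v = v) /\
  (forall v, isvert m v -> isvert m (g v) /\ size (g v) = size v) /\
  (forall u v, isvert m u -> isvert m v -> prefix u v = prefix (g u) (g v)) /\
  (forall w, isvert m w -> exists v, isvert m v /\ g v = w).

Definition comp (g h : tfun) : tfun := fun v => g (h v).
Definition tid : tfun := fun v => v.

Definition is_group (m : nat -> nat) (G : tfun -> Prop) : Prop :=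
  (forall g, G g -> is_aut m g) /\ G tid /\
  (forall g h, G g -> G h -> G (comp g h)) /\
  (forall g, G g -> exists h, G h /\ comp h g = tid /\ comp g h = tid).

Definition is_subgroup (m : nat -> nat) (G H : tfun -> Prop) : Prop :=
  is_group m H /\ (forall h, H h -> G h).

Definition bd_act (g : tfun) (x : bpoint) : bpoint :=
  fun i => nth 0 (g (trunc x i.+1)) i.

Definition Fix (m : nat -> nat) (H : tfun -> Prop) : bpoint -> Prop :=
  fun x => isbd m x /\ forall h, H h -> bd_act h x = x.

Definition Rist (m : nat -> nat) (G : tfun -> Prop) (v : vert) : tfun -> Prop :=
  fun g => G g /\ forall w, isvert m w -> ~ prefix v w -> g w = w.

Definition is_commutator (K : tfun -> Prop) (c : tfun) : Prop :=
  exists a b, K a /\ K b /\ comp c (comp b a) = comp a b.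

(* derived subgroup K' : the subgroup generated by the commutators, i.e. the
   finite products of commutators (inverses of commutators are commutators) *)
Inductive derived (K : tfun -> Prop) : tfun -> Prop :=
| derived_id : derived K tid
| derived_mul : forall c k, is_commutator K c -> derived K k -> derived K (comp c k).

Definition weakly_branch (m : nat -> nat) (G : tfun -> Prop) : Prop :=
  is_group m G /\
  (forall i, 0 < m i) /\   (* T infinite (spherically homogeneous by construction) *)
  (forall u v, isvert m u -> isvert m v -> size u = size v ->
     exists g, G g /\ g u = v) /\
  (forall v, isvert m v -> exists g, Rist m G v g /\ g <> tid).

Definition conj_sg (g : tfun) (H : tfun -> Prop) : tfun -> Prop :=
  fun k => exists h, H h /\ comp k g = comp g h.

(* Chabauty topology on Sub(G) (product topology on {0,1}^G):
   basic neighbourhoods {K | F1 in K, F2 disjoint from K}, F1,F2 finite in G *)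
Definition chab_basic (F1 F2 : seq tfun) (K : tfun -> Prop) : Prop :=
  (forall f, List.In f F1 -> K f) /\ (forall f, List.In f F2 -> ~ K f).

Definition chab_nbhd (m : nat -> nat) (G : tfun -> Prop) (K : tfun -> Prop)
  (P : (tfun -> Prop) -> Prop) : Prop :=
  exists F1 F2 : seq tfun,
    (forall f, List.In f (F1 ++ F2) -> G f) /\ chab_basic F1 F2 K /\
    forall K', is_subgroup m G K' -> chab_basic F1 F2 K' -> P K'.

Definition chab_closed (m : nat -> nat) (G : tfun -> Prop)
  (HH : (tfun -> Prop) -> Prop) : Prop :=
  (forall K, HH K -> is_subgroup m G K) /\
  (forall K, is_subgroup m G K -> ~ HH K -> chab_nbhd m G K (fun K' => ~ HH K')).

Definition G_invariant (G : tfun -> Prop) (HH : (tfun -> Prop) -> Prop) : Prop :=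
  forall g K, G g -> HH K -> HH (conj_sg g K).

Definition URS (m : nat -> nat) (G : tfun -> Prop) (HH : (tfun -> Prop) -> Prop) : Prop :=
  (exists H, HH H) /\ chab_closed m G HH /\ G_invariant G HH /\
  (forall KK : (tfun -> Prop) -> Prop, (exists K, KK K) -> chab_closed m G KK ->
     G_invariant G KK -> (forall K, KK K -> HH K) -> forall K, HH K -> KK K).

(* Hausdorff topology on F(dT), for the metric d(x,y) = 2^-(first index where
   x,y differ): hclose n A B  <->  d_H(A,B) <= 2^-n  (basic neighbourhoods) *)
Definition agree (n : nat) (x y : bpoint) : Prop := forall i, i < n -> x i = y i.
Definition hclose (n : nat) (A B : bpoint -> Prop) : Prop :=
  (forall a, A a -> exists b, B b /\ agree n a b) /\
  (forall b, B b -> exists a, A a /\ agree n a b).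

Definition indep (m : nat -> nat) (v w : vert) : Prop :=
  ~ exists u, isvert m u /\ prefix v u /\ prefix w u.

Definition in_Pi (m : nat -> nat) (V : vert -> Prop) : Prop :=
  (forall v, V v -> isvert m v) /\
  (forall v w, V v -> V w -> v <> w -> indep m v w).

Definition pi_perp (m : nat -> nat) (V : vert -> Prop) : bpoint -> Prop :=
  fun x => isbd m x /\ forall v, V v -> ~ in_bd_subtree v x.

Definition act_bset (g : tfun) (C : bpoint -> Prop) : bpoint -> Prop :=
  fun y => exists x, C x /\ y = bd_act g x.
Definition act_vset (g : tfun) (V : vert -> Prop) : vert -> Prop :=
  fun w => exists v, V v /\ w = g v.

Definition F_of (m : nat -> nat) (HH : (tfun -> Prop) -> Prop) (C : bpoint -> Prop) : Prop :=
  exists H, HH H /\ C = Fix m H.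

(* Main.v *)
From mathcomp Require Import all_boot.
From mathcomp Require Import boolp classical_sets filter.
Require Import Defs.
Set Implicit Arguments. Unset Strict Implicit. Unset Printing Implicit Defensive.
(* By minimality, any finite-level equivariant datum of H in HH that can only
   grow under small perturbations of H has constant cardinality, hence is
   locally constant. Applied to the level-n vertices v with no fixed point of H
   in dT_v, this is (i). Applied to pairs (v, h v), with compactness, it gives
   for h in H moving v a finite set E such that every conjugate of H by
   Rist(v) contains some e in E with e v = h v. Colouring Rist(v) by such e, a
   pigeonhole argument shows that H contains Rist(u)' for arbitrarily small
   neighbourhoods dT_u of any point moved by H. The property Rist(v)' <= H is
   again locally constant in H, so by compactness there is a depth N(l) such
   that Rist(w)' <= H whenever |w| = N(l) and Fix(H) misses the subtree at the
   ancestor of w at level l. Then sigma(C) cuts each maximal subtree missing C,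
   with root at level l, into its subtrees at level N(l). *)

(** * Words, truncations of boundary points, and König's lemma *)

Section Words.
Variable m : nat -> nat.
Implicit Types (u v w : vert) (x : bpoint).

Lemma prefix_size_eq u v w :
  prefix u w -> prefix v w -> size u = size v -> u = v.
Proof. by rewrite !prefixE => /eqP uw /eqP vw e_uv; rewrite -uw -vw e_uv. Qed.

Lemma isvert_prefix u v : prefix u v -> isvert m v -> isvert m u.
Proof.
move=> /prefixP[s ->] hv i hi; have := hv i.
by rewrite size_cat nth_cat hi; apply; rewrite ltn_addr.
Qed.

Lemma isvert_take n v : isvert m v -> isvert m (take n v).
Proof. exact/isvert_prefix/prefix_take. Qed.

Lemma size_trunc x n : size (trunc x n) = n.
Proof. exact: size_mkseq. Qed.

Lemma nth_trunc x n i : i < n -> nth 0 (trunc x n) i = x i.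
Proof. exact: nth_mkseq. Qed.

Lemma isvert_trunc x n : isbd m x -> isvert m (trunc x n).
Proof. by move=> hx i; rewrite size_trunc => hi; rewrite nth_trunc. Qed.

Lemma take_trunc x k n : k <= n -> take k (trunc x n) = trunc x k.
Proof.
move=> le_kn; apply: (@eq_from_nth _ 0).
  by rewrite size_take !size_trunc; case: ltngtP le_kn.
move=> i; rewrite size_take size_trunc.
have -> : (if k < n then k else n) = k by case: ltngtP le_kn.
by move=> hi; rewrite nth_take // !nth_trunc // (leq_trans hi).
Qed.

Lemma prefix_trunc x k n : k <= n -> prefix (trunc x k) (trunc x n).
Proof. by move=> le_kn; rewrite -(take_trunc _ le_kn) prefix_take. Qed.

Lemma trunc_ext x v : (forall i, i < size v -> nth 0 v i = x i) ->
  trunc x (size v) = v.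
Proof.
move=> h; apply: (@eq_from_nth _ 0); rewrite size_trunc // => i hi.
by rewrite nth_trunc // h.
Qed.

Lemma in_bd_subtree_trunc x n : in_bd_subtree (trunc x n) x.
Proof. by rewrite /in_bd_subtree size_trunc. Qed.

Lemma in_bd_subtree_prefix u v x :
  prefix u v -> in_bd_subtree v x -> in_bd_subtree u x.
Proof.
move=> uv hv; have := size_prefix uv; rewrite /in_bd_subtree => le_uv.
by rewrite -(take_trunc x le_uv) hv; move: uv; rewrite prefixE => /eqP.
Qed.

(** If the conclusion fails, [v] has descendants violating [P] at every level below it. As each
    vertex has finitely many children, this property passes to some child, and iterating builds a
    boundary point along which [P] never holds. *)
Lemma konig (P : vert -> Prop) v :
  isvert m v ->
  (forall u w, prefix u w -> isvert m w -> P u -> P w) ->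
  (forall x, isbd m x -> in_bd_subtree v x -> exists n, P (trunc x n)) ->
  exists n, size v <= n /\
    forall w, isvert m w -> size w = n -> prefix v w -> P w.
Proof.
move=> vv Pup Px; apply: contrapT => Nv.
pose bad u := isvert m u /\ forall n, size u <= n ->
  exists w, [/\ isvert m w, size w = n, prefix u w & ~ P w].
have badv : bad v.
  split=> // n le_n; apply: contrapT => h; apply: Nv; exists n; split=> // w vw sw pw.
  by apply: contrapT => nPw; apply: h; exists w.
have step u : exists i, bad u -> bad (rcons u i).
  case: (pselect (bad u)) => [bu|]; last by exists 0.
  apply: contrapT => h.
  have h' i : exists n, i < m (size u) -> size u < n /\
      forall w, isvert m w -> size w = n -> prefix (rcons u i) w -> P w.
    case: (ltnP i (m (size u))) => hi; last by exists 0.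
    apply: contrapT => hn; apply: h; exists i => _; split.
      move=> j; rewrite size_rcons nth_rcons ltnS leq_eqVlt.
      case: ltngtP => //= [hj _|-> _ //]; exact: bu.1.
    move=> n; rewrite size_rcons => le_n; apply: contrapT => hw; apply: hn.
    exists n => _; split=> // w vw sw pw.
    by apply: contrapT => nPw; apply: hw; exists w.
  have [f hf] := choice h'.
  (* Being deeper than [u], the violating vertex [w] at level [N] passes through some child [i];
     being at least as deep as [f i], it inherits [P] from its ancestor at that level. *)
  pose N := maxn (size u).+1 (\max_(i < m (size u)) f i).
  have [w [vw sw pw nPw]] : exists w, [/\ isvert m w, size w = N, prefix u w & ~ P w].
    by apply: bu.2; rewrite (leq_trans (leqnSn _)) ?leq_maxl.
  have lt_u : size u < size w by rewrite sw leq_maxl.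
  set i := nth 0 w (size u).
  have hi : i < m (size u) by apply: vw.
  have [lt_uf hP] := hf i hi.
  have le_fN : f i <= N.
    by rewrite leq_max (bigmax_sup (Ordinal hi)) ?orbT.
  apply: nPw; apply: (Pup (take (f i) w)); rewrite ?prefix_take //.
  apply: hP; first exact: isvert_take.
    by rewrite size_takel // sw.
  rewrite prefixE size_rcons take_takel // (take_nth 0) //.
  by move: pw; rewrite prefixE => /eqP ->.
have [f hf] := choice step.
pose s k := iter k (fun u => rcons u (f u)) v.
have bads k : bad (s k) by elim: k => //= k; apply: hf.
have sizes k : size (s k) = size v + k.
  by elim: k => [|k IHk] /=; rewrite ?addn0 // size_rcons IHk addnS.
have pres j k : prefix (s j) (s (j + k)).
  elim: k => [|k IHk]; first by rewrite addn0 prefix_refl.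
  by rewrite addnS /= (prefix_trans IHk) // -cats1 prefix_prefix.
pose x i := nth 0 (s i.+1) i.
have tx k : trunc x (size (s k)) = s k.
  apply: trunc_ext => i hi; rewrite /x.
  have aux a b : prefix a b -> i < size a -> nth 0 a i = nth 0 b i.
    by move=> /prefixP[t ->] ia; rewrite nth_cat ia.
  have hi' : i < size (s i.+1) by rewrite sizes addnS ltnS leq_addl.
  rewrite (aux _ _ (pres k i.+1) hi) addnC.
  by rewrite (aux _ _ (pres i.+1 k) hi').
have bx : isbd m x.
  move=> i; apply: (bads i.+1).1.
  by rewrite sizes addnS ltnS leq_addl.
have [n Pn] := Px x bx (tx 0).
have [w [vw sw pw nPw]] := (bads n).2 _ (leqnn _).
apply: nPw; apply: (Pup (trunc x n)) => //; apply: prefix_trans pw.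
by rewrite -tx prefix_trunc // sizes leq_addl.
Qed.

Fixpoint level n : seq vert :=
  if n is k.+1 then [seq rcons v i | v <- level k, i <- iota 0 (m k)] else [:: [::]].

Lemma mem_level n v : v \in level n <-> isvert m v /\ size v = n.
Proof.
elim: n v => [|n IHn] v.
  rewrite inE; split=> [/eqP -> //|[_ /size0nil -> //]].
split=> [/allpairsP[[u i] /= [/IHn [hu su]]]|].
  rewrite mem_iota add0n => /= hi ->; split; last by rewrite size_rcons su.
  move=> j; rewrite size_rcons nth_rcons ltnS leq_eqVlt.
  case: ltngtP => //= [hj _|-> _]; [exact: hu|by rewrite su].
case=> hv sv; apply/allpairsP; exists (take n v, nth 0 v n).
split=> /=; last by rewrite -take_nth ?sv // -sv take_size.
  by apply/IHn; split; [apply: isvert_take|rewrite size_takel // sv].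
by rewrite mem_iota add0n /=; apply: hv; rewrite sv.
Qed.

Lemma level_uniq n : uniq (level n).
Proof.
elim: n => //= n IHn; apply: allpairs_uniq (iota_uniq _ _) _ => //.
by move=> [u i] [v j] _ _ /= /rcons_inj [-> ->].
Qed.

End Words.

(** * Groups of tree automorphisms, boundary action, rigid stabilizers, conjugation *)

Section Group.
Variables (m : nat -> nat) (G : tfun -> Prop).
Hypothesis hG : is_group m G.
Implicit Types (u v w : vert) (g h : tfun).

(** Choosing the inverse lets conjugates and quotients be written as terms; the default [tid] never
    occurs for elements of a group, where [tinvP] applies. *)
Definition tinv g : tfun :=
  if pselect (exists h, comp h g = tid /\ comp g h = tid) is left p
  then projT1 (cid p) else tid.

Lemma tinvP (K : tfun -> Prop) g : is_group m K -> K g ->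
  [/\ K (tinv g), cancel g (tinv g) & cancel (tinv g) g].
Proof.
move=> [_ [_ [_ hK]]] Kg; have [h [Kh [hg gh]]] := hK g Kg.
have hgK : cancel g h by move=> v; exact: (congr1 (fun f => f v) hg).
have ghK : cancel h g by move=> v; exact: (congr1 (fun f => f v) gh).
rewrite /tinv; case: pselect => [p|[]]; last by exists h.
case: (cid p) => k /= [kg gk]; have -> // : k = h.
apply: funext => v; rewrite -{1}(ghK v).
exact: (congr1 (fun f => f (h v)) kg).
Qed.

Lemma groupV (K : tfun -> Prop) g : is_group m K -> K g -> K (tinv g).
Proof. by move=> hK Kg; case: (tinvP hK Kg). Qed.

Lemma groupM (K : tfun -> Prop) g h : is_group m K -> K g -> K h -> K (comp g h).
Proof. by move=> [_ [_ [hK _]]]; apply: hK. Qed.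

Lemma group1 (K : tfun -> Prop) : is_group m K -> K tid.
Proof. by case=> _ []. Qed.

Lemma tinvK g : G g -> cancel g (tinv g).
Proof. by move=> Gg; case: (tinvP hG Gg). Qed.

Lemma tinvVK g : G g -> cancel (tinv g) g.
Proof. by move=> Gg; case: (tinvP hG Gg). Qed.

Lemma tinv_inv g : G g -> tinv (tinv g) = g.
Proof.
move=> Gg; apply: funext => v.
by rewrite -[in LHS](tinvK Gg v) tinvK //; apply: groupV.
Qed.

Lemma aut_isvert g v : G g -> isvert m v -> isvert m (g v).
Proof. by move=> Gg hv; case: (hG.1 g Gg) => _ [/(_ v hv) []]. Qed.

Lemma aut_size g v : G g -> isvert m v -> size (g v) = size v.
Proof. by move=> Gg hv; case: (hG.1 g Gg) => _ [/(_ v hv) []]. Qed.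

Lemma aut_out g v : G g -> ~ isvert m v -> g v = v.
Proof. by move=> Gg; case: (hG.1 g Gg) => h _; apply: h. Qed.

Lemma aut_prefix g u v : G g -> isvert m v -> prefix u v -> prefix (g u) (g v).
Proof.
move=> Gg hv uv; case: (hG.1 g Gg) => _ [_ [h _]].
by rewrite -h //; apply: isvert_prefix uv hv.
Qed.

Lemma aut_take g n v : G g -> isvert m v -> g (take n v) = take n (g v).
Proof.
move=> Gg hv; have := aut_prefix Gg hv (prefix_take v n).
rewrite prefixE aut_size //; last exact: isvert_take.
move=> /eqP <-; rewrite size_take.
case: ltnP => // hn; rewrite -(aut_size Gg hv) take_size take_oversize //.
by rewrite aut_size.
Qed.

Lemma aut_trunc g x n : G g -> isbd m x -> trunc (bd_act g x) n = g (trunc x n).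
Proof.
move=> Gg hx; have hv : isvert m (trunc x n) := isvert_trunc hx.
rewrite -{1}(size_trunc x n) -(aut_size Gg hv); apply: trunc_ext => i.
rewrite aut_size // size_trunc => hi; rewrite /bd_act.
by rewrite -(take_trunc x hi) aut_take // nth_take.
Qed.

Lemma isbd_act g x : G g -> isbd m x -> isbd m (bd_act g x).
Proof.
move=> Gg hx i; rewrite -(nth_trunc _ (ltnSn i)) aut_trunc //.
apply: (aut_isvert Gg (isvert_trunc hx)).
by rewrite aut_size ?size_trunc //; apply: isvert_trunc.
Qed.

Lemma trunc_inj x y : (forall n, trunc x n = trunc y n) -> x = y.
Proof.
move=> h; apply: funext => i.
by rewrite -(nth_trunc x (ltnSn i)) h nth_trunc.
Qed.

Lemma bd_actK g x : G g -> isbd m x -> bd_act (tinv g) (bd_act g x) = x.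
Proof.
move=> Gg hx; apply: trunc_inj => n; have GV := groupV hG Gg.
by rewrite aut_trunc ?aut_trunc ?tinvK //; apply: isbd_act.
Qed.

Lemma bd_actVK g x : G g -> isbd m x -> bd_act g (bd_act (tinv g) x) = x.
Proof.
by move=> Gg hx; rewrite -{1}(tinv_inv Gg) bd_actK //; apply: groupV.
Qed.

Lemma FixP (K : tfun -> Prop) (KG : forall k, K k -> G k) x :
  Fix m K x <-> isbd m x /\ forall k n, K k -> k (trunc x n) = trunc x n.
Proof.
split=> -[hx h]; split=> // k.
  by move=> n Kk; rewrite -aut_trunc ?h //; apply: KG.
by move=> Kk; apply: trunc_inj => n; rewrite aut_trunc ?h //; apply: KG.
Qed.

Lemma Rist_out g v w : Rist m G v g -> ~ prefix v w -> g w = w.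
Proof.
move=> [Gg hg] nvw; case: (pselect (isvert m w)) => [vw|]; first exact: hg.
exact: aut_out.
Qed.

(** The point is that [v] itself is fixed: if [g v] differed from [v], it would be a vertex of the
    same length not below [v], hence fixed by [g], against injectivity. *)
Lemma Rist_fix g v w : Rist m G v g -> size w <= size v -> g w = w.
Proof.
move=> Rg le_wv; case: (pselect (isvert m w)) => [vw|]; last exact: aut_out Rg.1.
case: (pselect (prefix v w)) => [pvw|]; last exact: Rist_out.
have -> : w = v.
  apply: (prefix_size_eq (prefix_refl w) pvw).
  by apply/eqP; rewrite eqn_leq le_wv (size_prefix pvw).
have vv : isvert m v := isvert_prefix pvw vw.
apply: contrapT => ne; apply: (ne); apply: (can_inj (tinvK Rg.1)).
apply: (Rist_out Rg) => pv; apply: ne; symmetry.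
by apply: prefix_size_eq pv (prefix_refl _) _; rewrite aut_size //; exact: Rg.1.
Qed.

Lemma Rist_group v : is_group m (Rist m G v).
Proof.
split; first by move=> g [Gg _]; apply: hG.1.
split; first by split; [apply: group1 hG|].
split.
  move=> g h [Gg hg] [Gh hh]; split; first exact: groupM.
  by move=> w vw pw; rewrite /comp hh // hg.
move=> g [Gg hg]; have [Gi gK gVK] := tinvP hG Gg.
exists (tinv g); split; last by split; apply: funext.
by split=> // w vw pw; rewrite -{1}(hg w vw pw) gK.
Qed.

Lemma Rist_sub u v g : prefix u v -> Rist m G v g -> Rist m G u g.
Proof.
move=> uv [Gg hg]; split=> // w vw nuw; apply: hg => // vw'; apply: nuw.
exact: prefix_trans vw'.
Qed.

Definition tconj s g : tfun := comp s (comp g (tinv s)).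

Lemma conj_in (K : tfun -> Prop) s g : is_group m K -> K s -> K g -> K (tconj s g).
Proof.
by move=> hK Ks Kg; apply: (groupM hK Ks); apply: (groupM hK Kg); apply: groupV.
Qed.

Lemma conjK s g : G s -> tconj (tinv s) (tconj s g) = g.
Proof.
move=> Gs; apply: funext => v; rewrite /tconj /comp tinv_inv //.
by rewrite !tinvK.
Qed.

Lemma conjVK s g : G s -> tconj s (tconj (tinv s) g) = g.
Proof. by move=> Gs; rewrite -{1}(tinv_inv Gs) conjK //; apply: groupV. Qed.

Lemma Rist_conj s g v : G s -> isvert m v -> Rist m G v g ->
  Rist m G (s v) (tconj s g).
Proof.
move=> Gs vv Rg; split; first exact: (conj_in hG Gs Rg.1).
move=> w vw nsv; rewrite /tconj /comp (Rist_out Rg) ?tinvVK // => pv; apply: nsv.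
rewrite -[w](tinvVK Gs); apply: aut_prefix => //.
by apply: aut_isvert vw; apply: groupV.
Qed.

Lemma derived_Rist_conj s g v : G s -> isvert m v ->
  derived (Rist m G v) g -> derived (Rist m G (s v)) (tconj s g).
Proof.
move=> Gs vv; elim=> [|c k [a [b [Ra [Rb e]]]] _ IHk].
  have -> : tconj s tid = tid by apply: funext => w; apply: tinvVK.
  exact: derived_id.
have -> : tconj s (comp c k) = comp (tconj s c) (tconj s k).
  by apply: funext => w; rewrite /tconj /comp tinvK.
apply: derived_mul => //; exists (tconj s a), (tconj s b).
split; first exact: Rist_conj; split; first exact: Rist_conj.
apply: funext => w; rewrite /tconj /comp !tinvK //.
by have := congr1 (fun f => s (f (tinv s w))) e.
Qed.

Lemma conj_sgE s (K : tfun -> Prop) k : G s ->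
  conj_sg s K k <-> K (tconj (tinv s) k).
Proof.
move=> Gs; split=> [[h [Kh e]]|Kk].
  suff -> : tconj (tinv s) k = h by [].
  apply: funext => v; rewrite /tconj tinv_inv //.
  by have := congr1 (fun f => tinv s (f v)) e; rewrite /comp tinvK.
exists (tconj (tinv s) k); split=> //; apply: funext => v.
by rewrite /tconj /comp tinv_inv // tinvVK.
Qed.

Lemma conj_sgK s (K : tfun -> Prop) : G s -> conj_sg (tinv s) (conj_sg s K) = K.
Proof.
move=> Gs; have Gi := groupV hG Gs; apply/predeqP => k.
by rewrite !conj_sgE // tinv_inv // conjK.
Qed.

(** By injectivity each map preserves its own support, so where one of them moves a point the other
    fixes both that point and its image. *)
Lemma disjoint_commute a b w :
  (forall z, a z <> z -> b z = z) -> injective a -> injective b ->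
  a (b w) = b (a w).
Proof.
move=> dis ia ib; case: (pselect (a w = w)) => [e|ne].
  rewrite e; apply: contrapT => ne; apply: (ne).
  by have /ib e' := dis _ ne; rewrite !e'.
rewrite (dis w) //; symmetry; apply: dis => /ia; exact: ne.
Qed.

End Group.

(** * Chabauty neighbourhoods, compactness, and local constancy from minimality *)

Section Chabauty.
Variables (m : nat -> nat) (G : tfun -> Prop).
Hypothesis hG : is_group m G.
Implicit Types (K : tfun -> Prop) (P Q : (tfun -> Prop) -> Prop).
Notation nbhd := (chab_nbhd m G).

Lemma List_In_cat T (x : T) (s t : seq T) :
  List.In x (s ++ t) <-> List.In x s \/ List.In x t.
Proof. by elim: s => /= [|y s ->]; tauto. Qed.

Lemma chab_nbhdS K P Q :
  (forall K', is_subgroup m G K' -> P K' -> Q K') -> nbhd K P -> nbhd K Q.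
Proof.
move=> PQ [F1 [F2 [FG [KF h]]]]; exists F1, F2; do 2!split=> //.
by move=> K' sK' /(h _ sK'); apply: PQ.
Qed.

Lemma chab_nbhdT K : nbhd K (fun=> True).
Proof. by exists [::], [::]; split=> //; split. Qed.

Lemma chab_nbhdI K P Q : nbhd K P -> nbhd K Q -> nbhd K (fun K' => P K' /\ Q K').
Proof.
move=> [F1 [F2 [FG [[K1 K2] hP]]]] [E1 [E2 [EG [[L1 L2] hQ]]]].
exists (F1 ++ E1), (F2 ++ E2); split=> [f|].
  move=> hf; have [] : List.In f (F1 ++ F2) \/ List.In f (E1 ++ E2).
    by move: hf; rewrite !List_In_cat; tauto.
  exact: FG. exact: EG.
split; first by split=> f /List_In_cat [] hf; auto.
move=> K' sK' [h1 h2]; split; [apply: hP|apply: hQ] => //; split=> f hf.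
- by apply: h1; apply/List_In_cat; left.
- by apply: h2; apply/List_In_cat; left.
- by apply: h1; apply/List_In_cat; right.
by apply: h2; apply/List_In_cat; right.
Qed.

Lemma chab_nbhd_all (T : eqType) (s : seq T) (P : T -> (tfun -> Prop) -> Prop) K :
  (forall t, t \in s -> nbhd K (P t)) ->
  nbhd K (fun K' => forall t, t \in s -> P t K').
Proof.
elim: s => [|t s IHs] h; first by apply: chab_nbhdS (chab_nbhdT K).
have h1 := h t (mem_head _ _).
have h2 : nbhd K (fun K' => forall t, t \in s -> P t K').
  by apply: IHs => t' ht'; apply: h; rewrite in_cons ht' orbT.
apply: chab_nbhdS (chab_nbhdI h1 h2) => K' _ [p1 p2] t'.
by rewrite in_cons => /orP[/eqP ->|/p2].
Qed.

Lemma chab_nbhd_mem K k : G k -> K k -> nbhd K (fun K' => K' k).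
Proof.
move=> Gk Kk; exists [:: k], [::]; split; first by move=> f [<-|[]].
split; first by split=> // f [<-|[]].
by move=> K' _ [h _]; apply: h; left.
Qed.

Lemma chab_nbhd_notin K k : G k -> ~ K k -> nbhd K (fun K' => ~ K' k).
Proof.
move=> Gk Kk; exists [::], [:: k]; split; first by move=> f [<-|[]].
split; first by split=> // f [<-|[]].
by move=> K' _ [_ h]; apply: h; left.
Qed.

(* Compactness of closed subsets of Sub(G): membership in the limit along an
   ultrafilter is decided pointwise. *)
Lemma chab_compact (HH : (tfun -> Prop) -> Prop) (I : Type) (i0 : I)
    (Q : I -> (tfun -> Prop) -> Prop) :
  chab_closed m G HH ->
  (forall i j, exists k, forall K, Q i K \/ Q j K -> Q k K) ->
  (forall K, HH K -> exists i, nbhd K (fun K' => HH K' -> Q i K')) ->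
  exists i, forall K, HH K -> Q i K.
Proof.
move=> [HHsub HHcl] dir cov; apply: contrapT => NQ.
(* Directedness of [Q] makes the complements of the [Q i] in [HH] a filter base; it is proper
   because no [Q i] contains all of [HH]. *)
pose F (A : set (tfun -> Prop)) := exists i, forall K, HH K -> ~ Q i K -> A K.
have PF : ProperFilter F.
  split.
    move=> [i hi]; apply: NQ; exists i => K HK; apply: contrapT => nQ.
    exact: hi HK nQ.
  split; first by exists i0.
  - move=> A B [i hi] [j hj]; have [k hk] := dir i j; exists k => K HK nQ.
    by split; [apply: hi|apply: hj] => // h; apply: nQ; apply: hk; tauto.
  - by move=> A B AB [i hi]; exists i => K HK nQ; apply: AB; apply: hi.
have [U [UU FU]] := ultraFilterLemma PF.
have PU := @ultra_proper _ U UU.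
have UH : U HH by apply: FU; exists i0.
have UHS (A : set (tfun -> Prop)) : (forall K, HH K -> A K) -> U A.
  by move=> h; apply: filterS UH => K; apply: h.
pose L : tfun -> Prop := fun g => U (fun K => K g).
have LG g : L g -> G g.
  by move=> Lg; have [K [/HHsub [_ h] /h]] := filter_ex (filterI UH Lg).
have sL : is_subgroup m G L.
  split=> //; split; first by move=> g /LG; apply: hG.1.
  split; first by apply: UHS => K /HHsub [hK _]; exact: (group1 hK).
  split.
    move=> g h Lg Lh; apply: filterS (filterI UH (filterI Lg Lh)).
    by move=> K [/HHsub [hK _] [Kg Kh]]; exact: (groupM hK Kg Kh).
  move=> g Lg; have Gg := LG g Lg; exists (tinv g); split.
    by apply: filterS (filterI UH Lg) => K [/HHsub [hK _] Kg]; exact: (groupV hK Kg).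
  by split; apply: funext => v; rewrite /comp ?(tinvK hG) ?(tinvVK hG).
have nbhdU P : nbhd L P -> U (fun K => is_subgroup m G K -> P K).
  move=> [F1 [F2 [_ [[L1 L2] hP]]]].
  have U1 : U (fun K => forall f, List.In f F1 -> K f).
    elim: F1 L1 {hP} => [_|f s IHs h]; first by apply: UHS.
    apply: filterS (filterI (h f _) (IHs _)); first by move=> K [Kf hs] f' [<-|/hs].
    - by left.
    - by move=> f' hf'; apply: h; right.
  have U2 : U (fun K => forall f, List.In f F2 -> ~ K f).
    elim: F2 L2 {hP} => [_|f s IHs h]; first by apply: UHS.
    have Uf : U (fun K => ~ K f).
      have [Uf|//] := in_ultra_setVsetC (fun K => K f) UU.
      by case: (h f); [left|].
    apply: filterS (filterI Uf (IHs _)); first by move=> K [Kf hs] f' [<-|/hs].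
    by move=> f' hf'; apply: h; right.
  by apply: filterS (filterI U1 U2) => K [h1 h2] sK; apply: hP.
have HL : HH L.
  apply: contrapT => nL; have UN := nbhdU _ (HHcl _ sL nL).
  by have [K [HK nK]] := filter_ex (filterI UH UN); exact: nK (HHsub _ HK) HK.
(* Some [Q i] holds near the limit [L], hence on a set of [U], while [U] also contains the
   complement of [Q i]. *)
have [i /nbhdU UQ] := cov _ HL.
have UNQ : U (fun K => ~ Q i K) by apply: FU; exists i.
have [K [HK [hQ nQ]]] := filter_ex (filterI UH (filterI UQ UNQ)).
by apply: nQ; apply: hQ => //; apply: HHsub.
Qed.

Variable HH : (tfun -> Prop) -> Prop.
Hypothesis hU : URS m G HH.

Lemma URS_sub K : HH K -> is_subgroup m G K.
Proof. by case: hU => _ [[h _] _]; apply: h. Qed.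

Lemma URS_conj g K : G g -> HH K -> HH (conj_sg g K).
Proof. by case: hU => _ [_ [h _]]; apply: h. Qed.

(* The number of t with S K t is lower semicontinuous and G-invariant in K, so
   it is constant on HH by minimality; hence the set itself is locally
   constant. *)
Lemma URS_locally_constant (T : eqType) (s : seq T) (act : tfun -> T -> T)
    (S : (tfun -> Prop) -> T -> Prop) :
  uniq s ->
  (forall g t, G g -> t \in s -> act g t \in s) ->
  (forall g, G g -> {in s &, injective (act g)}) ->
  (forall g K t, G g -> HH K -> t \in s -> S K t -> S (conj_sg g K) (act g t)) ->
  (forall K t, HH K -> t \in s -> S K t -> nbhd K (fun K' => S K' t)) ->
  forall K0, HH K0 ->
  nbhd K0 (fun K => HH K -> forall t, t \in s -> (S K t <-> S K0 t)).
Proof.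
move=> us acts inj eqv opn K0 HK0.
pose sel K := [seq t <- s | `[< S K t >]].
have usel K : uniq (sel K) by apply: filter_uniq.
have selP K t : (t \in sel K) <-> t \in s /\ S K t.
  by rewrite mem_filter; split=> [/andP[/asboolP]|[? ?]] //; apply/andP; split => //; apply/asboolP.
have near K : HH K ->
    nbhd K (fun K' => forall t, t \in sel K -> t \in sel K').
  move=> HK; have : nbhd K (fun K' => forall t, t \in sel K -> S K' t).
    by apply: chab_nbhd_all => t /selP [ts St]; apply: opn.
  by apply: chab_nbhdS => K' _ h t ht; apply/selP; split; [case/selP: ht|apply: h].
have le_conj g K : G g -> HH K -> size (sel K) <= size (sel (conj_sg g K)).
  move=> Gg HK; rewrite -(size_map (act g)); apply: uniq_leq_size.
    rewrite map_inj_in_uniq // => t t' /selP [ts _] /selP [ts' _].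
    exact: inj.
  move=> _ /mapP [t /selP [ts St] ->]; apply/selP; split; [exact: acts|exact: eqv].
have cst K : HH K -> size (sel K) <= size (sel K0).
  have [_ [[_ HHcl] [_ min]]] := hU.
  suff h : HH K -> HH K /\ size (sel K) <= size (sel K0) by move=> /h [].
  (* The members of [HH] with at most as many selected points as [K0] form a nonempty closed
     invariant set; semicontinuity gives closedness, and minimality makes it all of [HH]. *)
  apply: (min (fun K => HH K /\ size (sel K) <= size (sel K0))).
  - by exists K0.
  - split=> [K1 [/URS_sub //]|K1 sK1 nK1].
    case: (pselect (HH K1)) => HK1; last first.
      by apply: chab_nbhdS (HHcl _ sK1 HK1) => K' _ nK' [].
    apply: chab_nbhdS (near _ HK1) => K' sK' sub [_ le]; apply: nK1; split=> //.
    exact: leq_trans (uniq_leq_size (usel _) sub) le.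
  - move=> g K1 Gg [HK1 le]; split; first exact: URS_conj.
    (* [le_conj] bounds a group by its conjugate, so it is applied to the conjugate of [K1] and to
       [tinv g], which leads back to [K1]. *)
    apply: leq_trans le; rewrite -[in X in _ <= X](conj_sgK hG K1 Gg).
    apply: le_conj; [exact: groupV hG Gg|exact: URS_conj].
  - by move=> K1 [].
apply: chab_nbhdS (near _ HK0) => K _ sub HK t ts.
have [_ e] := uniq_min_size (usel _) sub (cst _ HK).
have := e t; split=> St.
  by have /selP [] : t \in sel K0 by rewrite e; apply/selP.
by have /selP [] : t \in sel K by rewrite -e; apply/selP.
Qed.

End Chabauty.
Arguments chab_nbhd_mem m {G K k}.
Arguments chab_nbhd_notin m {G K k}.

(** * Derived rigid stabilizers inside members of a uniformly recurrent subgroup *)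

Section Branch.
Variables (m : nat -> nat) (G : tfun -> Prop).
Hypothesis hW : weakly_branch m G.
Implicit Types (u v w : vert) (x : bpoint) (g h r c : tfun).

Let hG : is_group m G := hW.1.

Lemma tinvM g h : G g -> G h -> tinv (comp g h) = comp (tinv h) (tinv g).
Proof.
move=> Gg Gh; apply: funext => v.
rewrite -[in LHS](tinvVK hG Gg v) -[in LHS](tinvVK hG Gh (tinv g v)).
exact: (tinvK hG (groupM hG Gg Gh)).
Qed.

Lemma tinv_conj s g : G s -> G g -> tinv (tconj s g) = tconj s (tinv g).
Proof.
move=> Gs Gg; have Gi := groupV hG Gs.
rewrite /tconj (tinvM Gs (groupM hG Gg Gi)) (tinvM Gg Gi) (tinv_inv hG) //.
Qed.

(** A nontrivial element of the rigid stabilizer moves some vertex [z] below [trunc x n]. Level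
    transitivity carries [z] onto the ray [x], and the conjugator fixes [trunc x n], the common
    ancestor of [z] and its image. *)
Lemma Rist_moves x n : isbd m x -> exists p : tfun * nat,
  [/\ n < p.2, Rist m G (trunc x n) p.1 & p.1 (trunc x p.2) <> trunc x p.2].
Proof.
move=> hx; have [_ [_ [tr wb]]] := hW.
have vv : isvert m (trunc x n) := isvert_trunc hx.
have [g [Rg ng]] := wb _ vv.
have [z gz] : exists z, g z <> z.
  by apply/existsNP => h; apply: ng; apply: funext.
have pz : prefix (trunc x n) z.
  by apply: contrapT => np; apply: gz; exact: (Rist_out hG Rg np).
have vz : isvert m z.
  by apply: contrapT => nv; apply: gz; exact: (aut_out hG Rg.1 nv).
have sz : n < size z.
  rewrite ltnNge; apply/negP => le; apply: gz.
  by apply: (Rist_fix hG Rg); rewrite size_trunc.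
have [s [Gs sE]] := tr z (trunc x (size z)) vz (isvert_trunc hx) (esym (size_trunc _ _)).
exists (tconj s g, size z); split=> //=.
  suff <- : s (trunc x n) = trunc x n by apply: (Rist_conj hG).
  move: pz; rewrite prefixE size_trunc => /eqP {1}<-.
  by rewrite (aut_take hG) // sE take_trunc // ltnW.
by rewrite -sE /tconj /comp (tinvK hG) // => /(can_inj (tinvK hG Gs)).
Qed.

(* The Rist(v)-orbit of x is infinite, because x is moved by rigid stabilizers
   of arbitrarily small neighbourhoods of x. *)
Lemma Rist_pigeonhole (T : finType) (F : tfun -> T) x n : isbd m x ->
  exists r r' j, [/\ n < j, Rist m G (trunc x n) r, Rist m G (trunc x n) r',
    F r = F r' & comp (tinv r) r' (trunc x j) <> trunc x j].
Proof.
move=> hx; have [f hf] := choice (fun k => @Rist_moves x k hx).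
(* The depths are chained: [r i] is supported below the truncation of [x] at depth [l i] and moves
   the one at depth [l i.+1]. *)
pose l i := iter i (fun k => (f k).2) n.
have lS i : l i < l i.+1 by rewrite /=; case: (hf (l i)).
have lmono i j : i <= j -> l i <= l j.
  apply: (homo_leq (r := leq)) => //; first exact: leq_trans.
  by move=> k; apply: ltnW.
pose r i := (f (l i)).1.
have Rr i : Rist m G (trunc x (l i)) (r i) by case: (hf (l i)).
have rmv i : r i (trunc x (l i.+1)) <> trunc x (l i.+1) by case: (hf (l i)).
have Rr0 i : Rist m G (trunc x n) (r i).
  by apply: Rist_sub (Rr i); apply: prefix_trunc; apply: (lmono 0).
have [i [j [lt_ij eF]]] : exists i j, i < j /\ F (r i) = F (r j).
  apply: contrapT => N.
  suff inj : injective (fun i : 'I_(#|T|.+1) => F (r i)).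
    by have := leq_card _ inj; rewrite card_ord ltnn.
  move=> i j eF; apply: val_inj; case: (ltngtP i j) => // lt; exfalso; apply: N.
    by exists i, j.
  by exists j, i.
exists (r i), (r j), (l i.+1); split=> //.
  exact: leq_trans (lS 0) (lmono 1 i.+1 _).
(* As [l j] is at least [l i.+1], [r j] fixes the vertex that [r i] moves. *)
rewrite /comp (Rist_fix hG (Rr j)) ?size_trunc ?lmono // => e.
by apply: (rmv i); rewrite -[in LHS]e (tinvVK hG (Rr i).1).
Qed.

(* The b below lies in the normal core of A in Rist(v); the colouring f says
   that A has finite index, and then so has its core. *)
Lemma core_moves (T : finType) (f : tfun -> T) (A : tfun -> Prop) x n :
  isbd m x ->
  (forall a b, A a -> A b -> A (comp a b)) ->
  (forall a, A a -> A (tinv a)) ->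
  (forall r r', Rist m G (trunc x n) r -> Rist m G (trunc x n) r' ->
     f r = f r' -> A (comp (tinv r) r')) ->
  exists b j, [/\ n < j, Rist m G (trunc x n) b, b (trunc x j) <> trunc x j &
    forall g, Rist m G (trunc x n) g -> A (comp (tinv g) (comp b g))].
Proof.
move=> hx AM AV fA; set R := Rist m G (trunc x n).
have hR : is_group m R by apply: Rist_group.
have [rep hrep] : {rep : T -> tfun & forall t,
    R (rep t) /\ ((exists g, R g /\ f g = t) -> f (rep t) = t)}.
  apply: (@choice _ _ (fun t g => R g /\ ((exists g, R g /\ f g = t) -> f g = t))) => t.
  case: (pselect (exists g, R g /\ f g = t)) => [[g [Rg fg]]|N].
    by exists g.
  by exists tid; split=> //; apply: (group1 hR).
(* The pigeonhole uses the whole vector of colours, so that [r] and [r'] have the same colour after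
   right multiplication by every representative. *)
have [r [r' [j [lt_j Rr Rr' eF mv]]]] :=
  @Rist_pigeonhole _ (fun r => [ffun t => f (comp r (rep t))]) x n hx.
exists (comp (tinv r) r'), j; split=> //.
  by apply: (groupM hR) => //; apply: (groupV hR).
move=> g Rg; have [Rs /(_ (ex_intro _ g (conj Rg erefl))) fs] := hrep (f g).
set s := rep (f g) in Rs fs.
have Aa : A (comp (tinv s) g) by apply: fA.
have As : A (comp (tinv (comp r s)) (comp r' s)).
  apply: fA; [exact: (groupM hR)|exact: (groupM hR)|].
  by have /ffunP/(_ (f g)) := eF; rewrite !ffunE.
have Gg := Rg.1; have Gs := Rs.1; have Gr := Rr.1.
(* Conjugating (r s)^-1 (r' s) by s^-1 g, both in [A], cancels s and leaves g^-1 (r^-1 r') g. *)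
have := AM _ _ (AV _ Aa) (AM _ _ As Aa).
rewrite (tinvM (groupV hG Gs) Gg) (tinvM Gr Gs) (tinv_inv hG) //.
congr A; apply: funext => z; rewrite /comp.
by rewrite !(tinvVK hG Gs).
Qed.

Variable HH : (tfun -> Prop) -> Prop.
Hypothesis hU : URS m G HH.

(** An element of [K] sending [v] to [w] also serves all subgroups near [K]; if [K] has none, nearby
    members of [HH] have none either. Compactness merges these local lists into one. *)
Lemma URS_returns v w : isvert m v -> isvert m w ->
  exists E : seq tfun, forall K, HH K -> (exists k, K k /\ k v = w) ->
    exists i, [/\ i < size E, K (nth tid E i) & nth tid E i v = w].
Proof.
move=> vv vw.
pose Q (E : seq tfun) (K : tfun -> Prop) := (exists k, K k /\ k v = w) ->
    exists i, [/\ i < size E, K (nth tid E i) & nth tid E i v = w].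
apply: (@chab_compact m G hG HH _ [::] Q); first by case: hU => _ [].
  move=> E1 E2; exists (E1 ++ E2) => K [] h hk; have [i [li Ki iw]] := h hk.
    exists i; rewrite size_cat nth_cat li; split=> //; exact: ltn_addr.
  exists (size E1 + i); rewrite size_cat ltn_add2l.
  by rewrite nth_cat (ltnNge (size E1 + i)) leq_addr /= addKn.
move=> K HK; case: (pselect (exists k, K k /\ k v = w)) => [[k [Kk kv]]|N].
  exists [:: k]; have Gk : G k by case: (URS_sub hU HK) => _; apply.
  by apply: chab_nbhdS (chab_nbhd_mem m Gk Kk) => K' _ Kk' _ _; exists 0.
exists [::].
(* Conjugation moves the pair (v, w), so local constancy is applied to all pairs from the two
   levels, under the diagonal action. *)
pose s := [seq (a, b) | a <- level m (size v), b <- level m (size w)].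
pose act g (p : vert * vert) := (g p.1, g p.2).
pose S (K : tfun -> Prop) (p : vert * vert) := exists k, K k /\ k p.1 = p.2.
have sP p : reflect (p.1 \in level m (size v) /\ p.2 \in level m (size w)) (p \in s).
  apply: (iffP allpairsP) => [[q [h1 h2 ->]]//|[h1 h2]].
  by exists p; split=> //; case: p {h1 h2}.
have lact g n a : G g -> a \in level m n -> g a \in level m n.
  move=> Gg /mem_level [va sa]; apply/mem_level.
  by rewrite (aut_size hG) //; split=> //; apply: (aut_isvert hG).
have loc : chab_nbhd m G K (fun K' => HH K' -> forall t, t \in s -> (S K' t <-> S K t)).
  apply: (URS_locally_constant hG hU (act := act)) => //.
  - by apply: allpairs_uniq; rewrite ?level_uniq // => -[a b] [a' b'].
  - by move=> g t Gg /sP [t1 t2]; apply/sP; split; apply: lact.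
  - move=> g Gg [a b] [a' b'] _ _ [e1 e2].
    by rewrite (can_inj (tinvK hG Gg) e1) (can_inj (tinvK hG Gg) e2).
  - move=> g K' t Gg HK' _ [k [Kk kt]]; exists (tconj g k); split.
      by apply/(conj_sgE hG) => //; rewrite (conjK hG).
    by rewrite /= /tconj /comp (tinvK hG) // kt.
  move=> K' t HK' _ [k [Kk kt]]; have Gk : G k by case: (URS_sub hU HK') => _; apply.
  by apply: chab_nbhdS (chab_nbhd_mem m Gk Kk) => K2 _ Kk2; exists k.
apply: chab_nbhdS loc => K' _ h HK' hk; exfalso; apply: N.
have vs : (v, w) \in s by apply/sP; split; apply/mem_level.
by case: (h HK' _ vs) => + _; apply.
Qed.

(** Write v for [trunc x n]. Every conjugate of [H] by Rist(v) contains an e from a finite list with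
    e v = h v. If r, r' share the same e, then Rist(h v) completes r^-1 r' to an element of [H]. So
    [core_moves] applies, and its b yields both [k] and the correction [y] supported in two
    subtrees. *)
Lemma Rist_realized H h x n :
  HH H -> H h -> isbd m x -> h (trunc x n) <> trunc x n ->
  exists k j, [/\ H k, n < j, k (trunc x j) <> trunc x j,
    prefix (trunc x n) (k (trunc x j)) &
    forall c, Rist m G (trunc x j) c -> exists y, [/\ G y, H (comp c y) &
      forall z, y z <> z ->
        isvert m z /\ (prefix (k (trunc x j)) z \/ prefix (h (trunc x n)) z)]].
Proof.
move=> HHH Hh hx ne; have [hH HG] := URS_sub hU HHH; have Gh := HG h Hh.
set v := trunc x n in ne *; set v' := h v in ne *.
have vv : isvert m v := isvert_trunc hx.
have vv' : isvert m v' by apply: (aut_isvert hG).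
have sv : size v = size v' := esym (aut_size hG Gh vv).
have dis z : prefix v z -> ~ prefix v' z.
  by move=> p p'; apply: ne; exact: esym (prefix_size_eq p p' sv).
have hR : is_group m (Rist m G v) by apply: Rist_group.
have hR' : is_group m (Rist m G v') by apply: Rist_group.
have com a e z : Rist m G v a -> Rist m G v' e -> a (e z) = e (a z).
  move=> Ra Re; apply: (@disjoint_commute a e z).
  - move=> z' az; apply: (Rist_out hG Re); apply: dis.
    by apply: contrapT => np; apply: az; apply: (Rist_out hG Ra np).
  - exact: can_inj (tinvK hG Ra.1).
  - exact: can_inj (tinvK hG Re.1).
have [E hE] := URS_returns vv vv'.
pose p r := fun e => `[< H (tconj (tinv r) e) /\ e v = v' >].
(* The colour of [r] is the index of the first suitable element of [E]; the extra value keeps the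
   ordinal type inhabited for [inord]. *)
pose f r : 'I_(size E).+1 := inord (find (p r) E).
have pf r : Rist m G v r -> has (p r) E.
  move=> Rr; have Gr := Rr.1.
  have [i [li Hi iv]] : exists i, [/\ i < size E,
      conj_sg r H (nth tid E i) & nth tid E i v = v'].
    apply: hE; first exact: (URS_conj hU).
    exists (tconj r h); split; first by apply/(conj_sgE hG) => //; rewrite (conjK hG).
    have e : tinv r v = v by rewrite -[in LHS](Rist_fix hG Rr (leqnn _)) (tinvK hG).
    by rewrite /tconj /comp e (Rist_fix hG Rr) // -/v' -sv.
  apply/(has_nthP tid); exists i => //; apply/asboolP; split=> //.
  by apply/(conj_sgE hG).
(* [A] is the projection to Rist(v) of the part of [H] lying in Rist(v) times Rist(v'). *)
pose A a := Rist m G v a /\ exists e, Rist m G v' e /\ H (comp a e).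
have [|||b [j [lt_j Rb bmv Ab]]] := @core_moves _ f A x n hx.
- move=> a b [Ra [e [Re He]]] [Rb [d [Rd Hd]]]; split; first exact: (groupM hR).
  exists (comp e d); split; first exact: (groupM hR').
  suff -> : comp (comp a b) (comp e d) = comp (comp a e) (comp b d).
    exact: (groupM hH).
  by apply: funext => z; rewrite /comp (com b e).
- move=> a [Ra [e [Re He]]]; split; first exact: (groupV hR).
  exists (tinv e); split; first exact: (groupV hR').
  suff -> : comp (tinv a) (tinv e) = tinv (comp a e) by apply: (groupV hH).
  rewrite (tinvM Ra.1 Re.1); apply: funext => z; rewrite /comp.
  by apply: com; [apply: (groupV hR)|apply: (groupV hR')].
- move=> r r' Rr Rr' ef; split; first by apply: (groupM hR) => //; apply: (groupV hR).
  have lf q : Rist m G v q -> find (p q) E < size E by move=> /pf; rewrite has_find.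
  have ef' : find (p r) E = find (p r') E.
    have := congr1 val ef; rewrite /= !inordK //; by rewrite ltnS ltnW ?lf.
  have /asboolP [He ev] := nth_find tid (pf r Rr).
  have /asboolP [He' _] := nth_find tid (pf r' Rr').
  rewrite -{}ef' in He'; set e := nth _ _ _ in He He' ev.
  have Gr := Rr.1; have Gr' := Rr'.1.
  have Ge : G e.
    by rewrite -(conjVK hG e Gr); apply: (conj_in hG) => //; apply: HG.
  have Re : Rist m G v' (tconj e (comp r (tinv r'))).
    rewrite -ev; apply: (Rist_conj hG) => //.
    by apply: (groupM hR) => //; apply: (groupV hR).
  exists (tconj e (comp r (tinv r'))); split=> //.
  (* This is the quotient of r^-1 e r by r'^-1 e r', both in [H]; the factor supported below v' is
     moved past r'. *)
  have -> : comp (comp (tinv r) r') (tconj e (comp r (tinv r'))) =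
      comp (tconj (tinv r) e) (tinv (tconj (tinv r') e)).
    apply: funext => z; rewrite tinv_conj //; last exact: (groupV hG).
    rewrite {1}/comp {1}/comp (com r') // /tconj !(tinv_inv hG) //.
  by apply: (groupM hH) => //; apply: (groupV hH).
set u := trunc x j in bmv *.
have vu : isvert m u := isvert_trunc hx.
have puv : prefix v u by apply/prefix_trunc/ltnW.
have [_ [e [Re Hk]]] : A b.
  have := Ab tid (group1 hR); congr A; apply: funext => z.
  exact: (tinvK hG (group1 hG)).
set k := comp b e in Hk; have Gk := HG k Hk.
have ku : k u = b u by rewrite /k /comp (Rist_out hG Re) //; apply: dis.
have kv : k v = v by rewrite /k /comp (Rist_fix hG Re) ?sv // (Rist_fix hG Rb).
have kv' : k v' = v' by rewrite /k /comp (Rist_fix hG Re) // (Rist_fix hG Rb) ?sv.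
exists k, j; rewrite ku; split=> //; rewrite -?ku.
  by rewrite -[v]kv; apply: (aut_prefix hG).
move=> c Rc; have Gc := Rc.1.
have Rc' : Rist m G v (tinv c) by apply: (groupV hR); apply: Rist_sub Rc.
have [_ [d [Rd Hd]]] := Ab _ Rc'; rewrite (tinv_inv hG) // in Hd.
(* [Hd] puts c b c^-1 d in [H]; dividing it by k = b e gives c y. *)
set y := comp b (comp (tinv c) (comp d (tinv k))).
have Hy : H (comp c y) by apply: (groupM hH Hd); apply: (groupV hH).
have Gy : G y.
  have -> : y = comp (tinv c) (comp c y) by apply: funext => z; rewrite /comp (tinvK hG).
  by apply: (groupM hG); [apply: (groupV hG)|apply: HG].
exists y; split=> // z; apply: contra_notP => N.
(* Pull z back to z' = k^-1 z. Off the subtrees at u and v', the maps c, d and e all fix z', so y z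
   = b z' = k z' = z. *)
case: (pselect (isvert m z)) => [vz|]; last exact: (aut_out hG Gy).
set z' := tinv k z.
have zE : k z' = z by apply: (tinvVK hG).
have vz' : isvert m z' by apply: (aut_isvert hG) => //; apply: (groupV hG).
have nv' : ~ prefix v' z'.
  move=> /(aut_prefix hG Gk vz'); rewrite kv' zE => q; apply: N; split=> //.
  by right.
have nu : ~ prefix u z'.
  move=> /(aut_prefix hG Gk vz'); rewrite zE => q; apply: N; split=> //.
  by left.
rewrite /y /comp -/z' (Rist_out hG Rd nv').
have -> : tinv c z' = z' by rewrite -[in LHS](Rist_out hG Rc nu) (tinvK hG).
by rewrite -[in RHS]zE /k /comp (Rist_out hG Re nv').
Qed.

(* Two elements c, d of Rist(u) are completed to elements c y, d z of H with y, z and Rist(u) pairwise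
   disjointly supported, so that [c, d] = [c y, d z]. *)
Lemma derived_Rist_sub H x : HH H -> isbd m x -> ~ Fix m H x ->
  exists n, forall k, derived (Rist m G (trunc x n)) k -> H k.
Proof.
move=> HHH hx nF; have [hH HG] := URS_sub hU HHH.
have [h [n [Hh hv]]] : exists h n, H h /\ h (trunc x n) <> trunc x n.
  apply: contrapT => N; apply: nF; apply/(FixP hG HG); split=> // k n Hk.
  by apply: contrapT => ne; apply: N; exists k, n.
have mono g i j : G g -> i < j -> g (trunc x i) <> trunc x i ->
    g (trunc x j) <> trunc x j.
  move=> Gg /ltnW ij ne e; apply: ne.
  by rewrite -(take_trunc x ij) (aut_take hG) ?e //; apply: isvert_trunc.
(* Three nested applications. The first only supplies [k], which moves [trunc x j] inside the
   subtree at [trunc x n]. Using [h] at depth j and then [k] at depth j1 gives corrections whose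
   supports can be separated. *)
have [k [j [Hk nj ku vku _]]] := Rist_realized HHH Hh hx hv.
have hu := mono _ _ _ (HG _ Hh) nj hv.
have [k1 [j1 [Hk1 jj1 ku1 uku1 real1]]] := Rist_realized HHH Hh hx hu.
have kuu1 := mono _ _ _ (HG _ Hk) jj1 ku.
have [k2 [j2 [Hk2 jj2 ku2 uku2 real2]]] := Rist_realized HHH Hk hx kuu1.
exists j2 => l0; elim=> [|c l [a [b [Ra [Rb e]]]] _ Hl]; first exact: (group1 hH).
apply: (groupM hH) => //.
have vx i : isvert m (trunc x i) := isvert_trunc hx.
have tp i i' : i < i' -> prefix (trunc x i) (trunc x i').
  by move=> /ltnW; apply: prefix_trunc.
have [y [Gy Hy my]] := real1 a (Rist_sub (tp _ _ jj2) Ra).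
have [z [Gz Hz mz]] := real2 b Rb.
have gp g i i' : H g -> i < i' -> prefix (g (trunc x i)) (g (trunc x i')).
  by move=> /HG Gg ii; apply: (aut_prefix hG) => //; apply: tp.
have sep g i t : H g -> g (trunc x i) <> trunc x i ->
    prefix (g (trunc x i)) t -> ~ prefix (trunc x i) t.
  move=> /HG Gg ne p q; apply: ne; apply: prefix_size_eq p q _.
  by rewrite (aut_size hG).
have yu t : prefix (trunc x j2) t -> y t = t.
  move=> pt; apply: contrapT => /my [_ [] p].
    by apply: sep ku1 p _ => //; apply: prefix_trans pt; apply: tp.
  apply: (sep _ _ _ Hh hu p); apply: prefix_trans pt; apply: tp.
  exact: ltn_trans jj2.
have zu t : prefix (trunc x j2) t -> z t = t.
  move=> pt; apply: contrapT => /mz [_ [] p].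
    exact: sep ku2 p pt.
  by apply: (sep _ _ _ Hk kuu1 p); apply: prefix_trans pt; apply: tp.
have yz t : y t <> t -> z t = t.
  move=> /my [_ py]; apply: contrapT => /mz [_ pz].
  (* The support of z lies below [trunc x j1] or k (trunc x j1), hence below [trunc x n]. That of y
     lies below k1 (trunc x j1), which is inside [trunc x j] but off [trunc x j1], or below h (trunc
     x j), which is off [trunc x n]. *)
  case: py => py; case: pz => pz.
  - apply: (sep _ _ _ Hk1 ku1 py); exact: prefix_trans pz.
  - apply: (sep _ _ _ Hk ku (prefix_trans (gp _ _ _ Hk jj1) pz)).
    exact: prefix_trans py.
  - apply: (sep _ _ _ Hh hv (prefix_trans (gp _ _ _ Hh nj) py)).
    apply: prefix_trans pz; apply: prefix_trans uku2; apply: tp.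
    exact: ltn_trans jj1.
  - apply: (sep _ _ _ Hh hv (prefix_trans (gp _ _ _ Hh nj) py)).
    apply: prefix_trans pz; apply: prefix_trans (gp _ _ _ Hk jj1).
    exact: vku.
have mvR c' t : Rist m G (trunc x j2) c' -> c' t <> t -> prefix (trunc x j2) t.
  by move=> Rc ne; apply: contrapT => np; apply: ne; apply: (Rist_out hG Rc np).
have inj g : G g -> injective g by move=> Gg; apply: can_inj (tinvK hG Gg).
have cyz t : y (z t) = z (y t) by apply: (@disjoint_commute y z) => //; apply: inj.
have cby t : b (y t) = y (b t).
  by apply: (@disjoint_commute b y) => [s /(mvR _ _ Rb)/yu||] //; apply: inj => //; exact: Rb.1.
have caz t : a (z t) = z (a t).
  by apply: (@disjoint_commute a z) => [s /(mvR _ _ Ra)/zu||] //; apply: inj => //; exact: Ra.1.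
have -> : c = comp (comp (comp a y) (comp b z)) (tinv (comp (comp b z) (comp a y))).
  apply: funext => t; set M := comp (comp b z) (comp a y).
  have GM : G M by apply: HG; apply: (groupM hH).
  rewrite -[in LHS](tinvVK hG GM t) -[in RHS]/(comp _ _).
  set s := tinv M t.
  rewrite {1}/M /comp -caz -/s.
  have := congr1 (fun f => f (z (y s))) e; rewrite /comp => ->.
  by rewrite -cby -cyz.
by apply: (groupM hH); [|apply: (groupV hH)]; apply: (groupM hH).
Qed.

End Branch.

(** * Local constancy of finite-level data on [HH], and a uniform depth *)

Definition meets (C : bpoint -> Prop) (v : vert) : Prop :=
  exists x, C x /\ in_bd_subtree v x.

Lemma meets_hclose n C C' v :
  hclose n C C' -> size v <= n -> meets C v <-> meets C' v.
Proof.
move=> [h h'] le_n; have tr a b : agree n a b -> in_bd_subtree v a <-> in_bd_subtree v b.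
  move=> ab; rewrite /in_bd_subtree; suff -> : trunc a (size v) = trunc b (size v) by [].
  by apply/eq_in_map => i; rewrite mem_iota => /= hi; apply: ab; apply: leq_trans le_n.
split=> [[a [/h [b [Cb ab]]]]|[b [/h' [a [Ca ab]]]]].
  by move=> /(tr _ _ ab) hb; exists b.
by move=> /(tr _ _ ab) ha; exists a.
Qed.

Section Final.
Variables (m : nat -> nat) (G : tfun -> Prop) (HH : (tfun -> Prop) -> Prop).
Hypotheses (hW : weakly_branch m G) (hU : URS m G HH).

Let hG : is_group m G := hW.1.

Lemma Fix_conj g (K : tfun -> Prop) : G g -> (forall k, K k -> G k) ->
  Fix m (conj_sg g K) = act_bset g (Fix m K).
Proof.
move=> Gg KG; have Gi := groupV hG Gg.
have cG k : conj_sg g K k -> G k.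
  move=> /(conj_sgE hG _ _ Gg) /KG Gk.
  by rewrite -(conjVK hG k Gg); apply: (conj_in hG).
apply/predeqP => y; split.
  move=> /(FixP hG cG) [hy fy]; exists (bd_act (tinv g) y).
  split; last by rewrite (bd_actVK hG).
  apply/(FixP hG KG); split; first exact: (isbd_act hG).
  move=> k n Kk; rewrite !(aut_trunc hG) //.
  have := fy (tconj g k) n; rewrite /tconj /comp => /(_ _)/(congr1 (tinv g)).
  rewrite (tinvK hG) //; apply; apply/(conj_sgE hG) => //.
  by rewrite -/(comp k (tinv g)) -/(comp g _) -/(tconj g k) (conjK hG).
move=> [x [/(FixP hG KG) [hx fx] ->]]; apply/(FixP hG cG); split.
  exact: (isbd_act hG).
move=> k n [h [Kh e]]; rewrite (aut_trunc hG) //.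
by have := congr1 (fun f => f (trunc x n)) e; rewrite /= /comp (fx h).
Qed.

Lemma meets_act g (C : bpoint -> Prop) v : G g -> (forall x, C x -> isbd m x) ->
  isvert m v -> meets (act_bset g C) (g v) <-> meets C v.
Proof.
move=> Gg Cb vv; rewrite /meets /in_bd_subtree (aut_size hG) //; split.
  move=> [_ [[x [Cx ->]]]]; rewrite (aut_trunc hG) //; last exact: Cb.
  by move=> /(can_inj (tinvK hG Gg)) e; exists x.
move=> [x [Cx e]]; exists (bd_act g x); split; first by exists x.
by rewrite (aut_trunc hG) ?e //; apply: Cb.
Qed.

Lemma not_Fix_trunc (K : tfun -> Prop) x : (forall k, K k -> G k) -> isbd m x ->
  ~ Fix m K x -> exists n k, K k /\ k (trunc x n) <> trunc x n.
Proof.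
move=> KG hx nF; apply: contrapT => N; apply: nF; apply/(FixP hG KG); split=> //.
by move=> k n Kk; apply: contrapT => ne; apply: N; exists n, k.
Qed.

(** By König's lemma, finitely many elements of [K] already move every vertex below [v] at some
    level; subgroups near [K] contain the same elements. *)
Lemma misses_open (K : tfun -> Prop) v : is_subgroup m G K -> isvert m v ->
  ~ meets (Fix m K) v -> chab_nbhd m G K (fun K' => ~ meets (Fix m K') v).
Proof.
move=> [hK KG] vv nm.
have [||n [le_n hn]] := @konig m (fun w => exists k, K k /\ k w <> w) v vv.
- move=> u w uw vw [k [Kk ku]]; exists k; split=> // kw; apply: ku.
  move: uw; rewrite prefixE => /eqP <-.
  by rewrite (aut_take hG) ?kw //; apply: KG.
- move=> x hx vx; apply: (not_Fix_trunc KG hx) => Fx; apply: nm.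
  by exists x.
apply: (@chab_nbhdS _ _ _ (fun K' => forall t, t \in level m n ->
  prefix v t -> exists k, K' k /\ k t <> t)); last first.
  apply: chab_nbhd_all => t /mem_level [vt st].
  case: (pselect (prefix v t)) => [pt|npt]; last first.
    by apply: chab_nbhdS (chab_nbhdT m G K) => K' _ _ /npt.
  have [k [Kk kt]] := hn t vt st pt.
  by apply: chab_nbhdS (chab_nbhd_mem m (KG k Kk) Kk) => K' _ Kk' _; exists k.
move=> K' [_ KG'] h [x [/(FixP hG KG') [hx fx] vx]].
have [||k [Kk]] := h (trunc x n).
- by apply/mem_level; rewrite size_trunc; split=> //; apply: isvert_trunc.
- by rewrite -vx; apply: prefix_trunc.
by rewrite fx.
Qed.

Lemma level_act g n v : G g -> v \in level m n -> g v \in level m n.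
Proof.
move=> Gg /mem_level [vv sv]; apply/mem_level.
by rewrite (aut_size hG) //; split=> //; apply: (aut_isvert hG).
Qed.

(** Missing a subtree is the open condition, so local constancy is applied to the negation. *)
Lemma meets_locally_constant n H0 : HH H0 ->
  chab_nbhd m G H0 (fun H => HH H -> forall v, v \in level m n ->
    (meets (Fix m H) v <-> meets (Fix m H0) v)).
Proof.
move=> HH0.
have loc : chab_nbhd m G H0 (fun H => HH H -> forall v, v \in level m n ->
    (~ meets (Fix m H) v <-> ~ meets (Fix m H0) v)).
  apply: (URS_locally_constant hG hU (act := fun g => g)
            (S := fun H v => ~ meets (Fix m H) v)) => //.
  - exact: level_uniq.
  - by move=> g v; apply: level_act.
  - by move=> g Gg v w _ _; apply: (can_inj (tinvK hG Gg)).
  - move=> g K v Gg HK /mem_level [vv _]; have [_ KG] := URS_sub hU HK.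
    by rewrite Fix_conj // meets_act // => x [].
  - move=> K v HK /mem_level [vv _]; apply: misses_open => //.
    exact: (URS_sub hU).
apply: chab_nbhdS loc => H _ h HHH v /(h HHH v) e.
by split=> ?; apply: contrapT => /e.
Qed.

Definition contains_derived_Rist (K : tfun -> Prop) v : Prop :=
  forall k, derived (Rist m G v) k -> K k.

Lemma contains_derived_Rist_prefix K u v : prefix u v ->
  contains_derived_Rist K u -> contains_derived_Rist K v.
Proof.
move=> uv h k dk; apply: h; elim: dk => [|c l [a [b [Ra [Rb e]]]] _ IHl].
  exact: derived_id.
by apply: derived_mul => //; exists a, b; do 2!(split; first exact: Rist_sub uv _).
Qed.

(** Failure is witnessed by a single element outside the subgroup, which stays outside nearby ones;
    so here too the negation is the open condition. *)
Lemma contains_derived_Rist_locally_constant n H0 : HH H0 ->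
  chab_nbhd m G H0 (fun H => HH H -> forall v, v \in level m n ->
    (contains_derived_Rist H v <-> contains_derived_Rist H0 v)).
Proof.
move=> HH0.
have loc : chab_nbhd m G H0 (fun H => HH H -> forall v, v \in level m n ->
    (~ contains_derived_Rist H v <-> ~ contains_derived_Rist H0 v)).
  apply: (URS_locally_constant hG hU (act := fun g => g)
            (S := fun H v => ~ contains_derived_Rist H v)) => //.
  - exact: level_uniq.
  - by move=> g v; apply: level_act.
  - by move=> g Gg v w _ _; apply: (can_inj (tinvK hG Gg)).
  - move=> g K v Gg HK /mem_level [vv _]; apply: contra_not => h k dk.
    have /h /(conj_sgE hG) := derived_Rist_conj hG Gg vv dk.
    by rewrite (conjK hG) //; apply.
  - move=> K v HK _ /existsNP [k /not_implyP [dk nk]].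
    have Gk : G k.
      elim: dk {nk} => [|c l [a [b [[Ga _] [[Gb _] e]]]] _ Gl]; first exact: (group1 hG).
      apply: (groupM hG) => //.
      have -> : c = comp (comp a b) (tinv (comp b a)).
        rewrite -e; apply: funext => z; rewrite /comp.
        by have := tinvVK hG (groupM hG Gb Ga) z; rewrite /comp => ->.
      by apply: (groupM hG); [|apply: (groupV hG)]; apply: (groupM hG).
    apply: chab_nbhdS (chab_nbhd_notin m Gk nk) => K' _ nk' h.
    exact: nk' (h _ dk).
apply: chab_nbhdS loc => H _ h HHH v /(h HHH v) e.
by split=> ?; apply: contrapT => /e.
Qed.

(** For one [K], König's lemma and [derived_Rist_sub] give a depth; local constancy at two levels
    extends it to a neighbourhood, and compactness to all of [HH]. *)
Lemma uniform_depth l : exists n, l <= n /\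
  forall H w, HH H -> isvert m w -> size w = n ->
    ~ meets (Fix m H) (take l w) -> contains_derived_Rist H w.
Proof.
(* Bounding [size w] below, instead of fixing it, makes [Q] monotone in [n], hence directed. *)
pose Q n (K : tfun -> Prop) := forall w, isvert m w -> n <= size w -> l <= size w ->
    ~ meets (Fix m K) (take l w) -> contains_derived_Rist K w.
suff [n hn] : exists n, forall K, HH K -> Q n K.
  exists (maxn l n); split=> [|H w HHH vw sw]; first exact: leq_maxl.
  by apply: hn => //; rewrite sw ?leq_maxl ?leq_maxr.
apply: (@chab_compact m G hG HH _ 0 Q); first by case: hU => _ [].
  move=> i j; exists (maxn i j) => K hK w vw; rewrite geq_max => /andP[iw jw] lw.
  by case: hK; apply.
move=> K HK; have [hK KG] := URS_sub hU HK.
(* The alternative [meets] lets König's lemma run from the root; the guard on the length makes [P]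
   pass to descendants. *)
pose P w := l <= size w /\ (meets (Fix m K) (take l w) \/ contains_derived_Rist K w).
have [||| n [_ hn]] := @konig m P [::].
- by [].
- move=> u w uw vw [lu h]; split; first exact: leq_trans (size_prefix uw).
  case: h => [h|h]; last by right; apply: contains_derived_Rist_prefix h.
  by left; move: uw h; rewrite prefixE => /eqP <-; rewrite take_takel.
- move=> x hx _; case: (pselect (meets (Fix m K) (trunc x l))) => [mt|nm].
    by exists l; rewrite /P size_trunc take_trunc //; split=> //; left.
  have [|n dn] := derived_Rist_sub hW hU HK hx.
    by move=> Fx; apply: nm; exists x; split=> //; apply: in_bd_subtree_trunc.
  exists (maxn l n); rewrite /P size_trunc leq_maxl; split=> //; right.
  by apply: contains_derived_Rist_prefix dn; apply: prefix_trunc; apply: leq_maxr.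
exists n.
have loc := chab_nbhdI (meets_locally_constant l HK)
  (contains_derived_Rist_locally_constant n HK).
apply: chab_nbhdS loc => K' _ [h1 h2] HK' w vw nw lw.
have tl : take l w \in level m l.
  by apply/mem_level; split; [apply: isvert_take|rewrite size_takel].
have tn : take n w \in level m n.
  by apply/mem_level; split; [apply: isvert_take|rewrite size_takel].
move=> nm; apply: contains_derived_Rist_prefix (prefix_take w n) _.
apply/(h2 HK' _ tn).
have [le_l h] : P (take n w).
  apply: hn; [exact: isvert_take|exact: size_takel|exact: prefix0s].
rewrite size_takel // in le_l; move: h nm.
by rewrite take_takel // => -[/(h1 HK' _ tl)|].
Qed.

End Final.

(** * Continuity of the fixed-point map and construction of the section *)

Theorem theorem5p17 (m : nat -> nat) (G : tfun -> Prop)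
  (HH : (tfun -> Prop) -> Prop) :
  weakly_branch m G -> URS m G HH ->
  (* (i) H |-> Fix(H) is continuous on HH (Chabauty -> Hausdorff) *)
  (forall H0, HH H0 -> forall n : nat,
     chab_nbhd m G H0 (fun H => HH H -> hclose n (Fix m H0) (Fix m H))) /\
  (* (ii) *)
  exists sigma : (bpoint -> Prop) -> (vert -> Prop),
    (* sigma maps F_HH into Pi(T) *)
    (forall C, F_of m HH C -> in_Pi m (sigma C)) /\
    (* continuity (each coordinate v of {0,1}^V(T) is locally constant) *)
    (forall C, F_of m HH C -> forall v, isvert m v ->
       exists n : nat, forall C', F_of m HH C' -> hclose n C C' ->
         (sigma C v <-> sigma C' v)) /\
    (* G-equivariance *)
    (forall g C, G g -> F_of m HH C -> sigma (act_bset g C) = act_vset g (sigma C)) /\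
    (* (a) pi_perp o sigma = id *)
    (forall C, F_of m HH C -> pi_perp m (sigma C) = C) /\
    (* (b) *)
    (forall H, HH H -> forall v, sigma (Fix m H) v ->
       forall k, derived (Rist m G v) k -> H k).
Proof.
move=> hW hU; have hG : is_group m G := hW.1; split.
  move=> H0 HH0 n.
  (* Closeness at scale [n] only depends on which level-[n] subtrees are met. *)
  apply: chab_nbhdS (meets_locally_constant hW hU n HH0) => H _ h HHH.
  have lv x K : Fix m K x -> trunc x n \in level m n.
    by case=> hx _; apply/mem_level; rewrite size_trunc; split=> //; apply: isvert_trunc.
  have ag x y : in_bd_subtree (trunc x n) y -> agree n y x.
    rewrite /in_bd_subtree size_trunc => e i hi.
    by rewrite -(nth_trunc y hi) e nth_trunc.
  have self K x : Fix m K x -> meets (Fix m K) (trunc x n).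
    by move=> Fx; exists x; split=> //; apply: in_bd_subtree_trunc.
  split=> x Fx.
    have [y [Fy xy]] := (h HHH _ (lv _ _ Fx)).2 (self _ _ Fx).
    by exists y; split=> // i hi; rewrite (ag _ _ xy).
  have [y [Fy xy]] := (h HHH _ (lv _ _ Fx)).1 (self _ _ Fx).
  by exists y; split=> //; apply: ag.
have [N hN] := choice (uniform_depth hW hU).
(* The condition on [j] makes [take l w] the root of a maximal subtree missing [C]; [w] is one of
   its descendants at depth [N l]. *)
pose sigma (C : bpoint -> Prop) w := isvert m w /\ exists l,
  [/\ size w = N l, ~ meets C (take l w) & forall j, j < l -> meets C (take j w)].
have Nle l : l <= N l by case: (hN l).
exists sigma; split; [|split; [|split; [|split]]].
- move=> C _; split=> [v []//|v w [vv [l [sv nv mv]]] [vw [l' [sw nw mw]]] ne].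
  move=> [u [vu [pv pw]]].
  have tk k a : prefix a u -> k <= size a -> take k a = take k u.
    by rewrite prefixE => /eqP {2}<- ka; rewrite take_takel.
  have ls : l <= size v by rewrite sv.
  have ls' : l' <= size w by rewrite sw.
  (* Below a common vertex the prefixes of v and w agree, so maximality forces l = l', and then v
     and w have the same length. *)
  case: (ltngtP l l') => ll.
  + apply: nv; rewrite (tk _ _ pv ls) -(tk _ _ pw); first exact: mw.
    exact: leq_trans (ltnW ll) ls'.
  + apply: nw; rewrite (tk _ _ pw ls') -(tk _ _ pv); first exact: mv.
    exact: leq_trans (ltnW ll) ls.
  + by apply: ne; apply: (prefix_size_eq pv pw); rewrite sv sw ll.
- move=> C _ v vv; exists (size v) => C' _ hC.
  have e j : meets C (take j v) <-> meets C' (take j v).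
    by apply: meets_hclose hC _; rewrite size_take_min geq_minr.
  split=> -[_ [l [sv nv mv]]]; split=> //; exists l; split=> //.
  + by move=> /e.
  + by move=> j /mv /e.
  + by move=> /e.
  + by move=> j /mv /e.
- move=> g C Gg [H [HHH ->]]; set C' := Fix m H.
  have Cb x : C' x -> isbd m x by case.
  have key v : isvert m v -> sigma (act_bset g C') (g v) <-> sigma C' v.
    move=> vv; have me j : meets (act_bset g C') (take j (g v)) <-> meets C' (take j v).
      rewrite -(aut_take hG) //; apply: (meets_act hW) => //; exact: isvert_take.
    rewrite /sigma (aut_size hG) //.
    split=> -[_ [l [sv nv mv]]]; split=> //.
    + by exists l; split=> //; [move=> /me|move=> j /mv /me].
    + exact: (aut_isvert hG).
    + by exists l; split=> //; [move=> /me|move=> j /mv /me].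
  apply/predeqP => w; split=> [sw|[v [sv ->]]].
    have e : w = g (tinv g w) by rewrite (tinvVK hG).
    exists (tinv g w); split=> //; apply/key; last by rewrite -e.
    by apply: (aut_isvert hG); [apply: (groupV hG)|case: sw].
  by apply/key => //; case: sv.
- move=> C [H [HHH ->]]; have [hH HG] := URS_sub hU HHH.
  apply/predeqP => x; split=> [[hx nx]|Fx].
    apply: contrapT => nF.
    (* A vertex of the ray moved by [H] carries no fixed point, so a least level l at which the ray
       misses [Fix m H] exists; [trunc x (N l)] is then in [sigma]. *)
    have ex : exists l, `[< ~ meets (Fix m H) (trunc x l) >].
      have [n [k [Hk kn]]] := not_Fix_trunc hW HG hx nF.
      exists n; apply/asboolP => -[y [/(FixP hG HG) [hy fy]]].
      by rewrite /in_bd_subtree size_trunc => e; apply: kn; rewrite -e fy.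
    case: (ex_minnP ex) => l /asboolP nl min.
    apply: (nx (trunc x (N l))); last exact: in_bd_subtree_trunc.
    split; first exact: isvert_trunc.
    exists l; split; rewrite ?size_trunc ?take_trunc // => j jl.
    rewrite take_trunc; last exact: leq_trans (ltnW jl) (Nle l).
    apply: contrapT => nj; have := min j; rewrite leqNgt jl => /(_ _) h.
    by apply: notF; apply: h; apply/asboolP.
  split=> [|v [vv [l [_ nv _]]] xv]; first by case: Fx.
  by apply: nv; exists x; split=> //; apply: in_bd_subtree_prefix xv; apply: prefix_take.
- by move=> H HHH v [vv [l [sv nv _]]]; case: (hN l) => _; apply.
Qed.
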